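(* The sequence $\big(f(2p+1)\big)_{p=0}^{\infty}$ is convex and logarithmically convex.
   Context: For integers $m,l\geq 1$, the Eulerian number $A(m,l)$ is the number of permutations of $\{1,\ldots,m\}$ in which exactly $l-1$ elements are greater than the previous element. For $m\geq 1$ put $M_m=\max_{1\leq l\leq m}A(m,l)=A\big(m,\lfloor\frac{m}{2}\rfloor+1\big)$ and $f(m)=\frac{M_m}{m!}$. Equivalently, $f(m)=J_{m+1}(1)$ if $m$ is even and $f(m)=J_{m+1}(0)$ if $m$ is odd, where $J_n(r)=\frac{1}{\pi}\int_{-\infty}^{\infty}\operatorname{sinc}^n(t)\cos(rt)\,dt$ with $\operatorname{sinc}(x)=\frac{\sin x}{x}$ for $x\neq0$ and $\operatorname{sinc}(0)=1$. A sequence $(a_p)_{p\geq p_0}$ is convex if $a_{p-1}+a_{p+1}\geq 2a_p$ for all $p\geq p_0+1$; a positive sequence is logarithmically convex if $a_{p-1}a_{p+1}\geq a_p^2$ for all $p\geq p_0+1$. *)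

(* Defs.v *)
From HB Require Import structures.
From mathcomp Require Import all_boot all_order all_algebra all_fingroup.
From mathcomp Require Import reals.

Set Implicit Arguments.
Unset Strict Implicit.
Unset Printing Implicit Defensive.

Import Order.TTheory GRing.Theory Num.Theory.

Local Open Scope ring_scope.

(* A permutation s : 'S_m is read as the word s 0, s 1, ..., s (m - 1), that is,
   a permutation of {0, ..., m - 1} instead of {1, ..., m}. The first entry has
   no previous element, so it is never counted. *)
Definition ascents (m : nat) (s : 'S_m) : nat :=
  #|[set i : 'I_m |
      [exists j : 'I_m, (nat_of_ord i == j.+1)%N && (s j < s i)%N]]|.

(* "Exactly l - 1 ascents" is written without truncated subtraction. *)
Definition eulerian (m l : nat) : nat :=
  #|[set s : 'S_m | ((ascents s).+1 == l)%N]|.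

Definition max_eulerian (m : nat) : nat :=
  (\max_(1 <= l < m.+1) eulerian m l)%N.

Definition eulerian_ratio (R : realType) (m : nat) : R :=
  (max_eulerian m)%:R / (m`!)%:R.

(* The inequality at index p + 1, p >= 0, for a sequence starting at 0. *)
Definition convex_seq (R : realType) (a : nat -> R) : Prop :=
  forall p : nat, 2 * a p.+1 <= a p + a p.+2.

Definition log_convex_seq (R : realType) (a : nat -> R) : Prop :=
  (forall p : nat, 0 < a p) /\
  (forall p : nat, a p.+1 ^+ 2 <= a p * a p.+2).

(* Main.v *)
(* Let c_n be the coefficient sequence of (1 + X + ... + X^(q-1))^n, a discrete
   B-spline. It is palindromic, so the central coefficient of c_(2n) is the sum
   of the squares of c_n, while the central coefficient of c_(2n+2) is the inner
   product of c_n with a translate of c_(n+2). By Cauchy-Schwarz the central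
   coefficients are log-convex in n. Divided by q^(2n-1), the central
   coefficient of c_(2n) tends to A(2n-1,n)/(2n-1)! as q goes to infinity: this
   follows from the explicit formula
     A(m,l) = sum_(i < l) (-1)^i C(m+1,i) (l-i)^m.
   That formula and the location of the maximum of A(m,.) come from the
   recurrence obtained by inserting the largest letter into a permutation.
   Convexity follows from log-convexity by AM-GM. *)
Require Import Defs.
From HB Require Import structures.
From mathcomp Require Import all_boot all_order all_algebra all_fingroup.
From mathcomp Require Import reals.
From mathcomp Require Import boolp classical_sets filter topology normedtype.
From mathcomp Require Import sequences.
From mathcomp Require Import zify ring lra.

Set Implicit Arguments.
Unset Strict Implicit.
Unset Printing Implicit Defensive.

Import Order.TTheory GRing.Theory Num.Theory.
Local Open Scope ring_scope.

(** * Ascents under insertion of the largest letter *)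

(** A total function on [nat], with junk value 0 from [m] on, so that inserting a letter becomes a
    plain index shift. *)
Definition word (m : nat) (s : 'S_m) (k : nat) : nat :=
  if insub k is Some i then nat_of_ord (s i) else 0%N.

Lemma wordE (m : nat) (s : 'S_m) (i : 'I_m) : word s i = s i.
Proof. by rewrite /word valK. Qed.

Lemma ascents_word (m : nat) (s : 'S_m) :
  ascents s = (\sum_(1 <= k < m) (word s k.-1 < word s k)%N)%N.
Proof.
rewrite /ascents -sum1dep_card big_mkcond /=.
case: m s => [|m] s; first by rewrite big_ord0 big_geq.
rewrite big_ord_recl big_add1 big_mkord /= -[RHS]add0n; congr (_ + _)%N.
  by case: existsP => // -[].
apply: eq_bigr => i _.
have -> : word s i = s (widen_ord (leqnSn m) i) by rewrite -wordE.
have -> : word s i.+1 = s (lift ord0 i) by rewrite -wordE.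
case: existsP => [[j /andP[/eqP e lt_s]]|nex].
  suff -> : widen_ord (leqnSn m) i = j by rewrite lt_s.
  by apply: val_inj => /=; move: e; rewrite /= /bump /=; lia.
by case: ltnP => // lt_s; case: nex; exists (widen_ord (leqnSn m) i); rewrite lt_s /= eqxx.
Qed.

(* Inserting the maximum m at position i creates an ascent, and destroys the
   ascent (i-1, i) if there was one; in front it changes nothing. *)
Lemma ascents_insert (m i : nat) (g h : nat -> nat) :
  (i <= m)%N -> (forall k, k < m -> g k < m)%N ->
  (forall k, k < i -> h k = g k)%N -> h i = m ->
  (forall k, i <= k < m -> h k.+1 = g k)%N ->
  (\sum_(1 <= k < m.+1) (h k.-1 < h k)%N =
   \sum_(1 <= k < m) (g k.-1 < g k)%N
     + ((0 < i) && ~~ ((i < m) && (g i.-1 < g i))))%N.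
Proof.
case: i => [|i] le_im g_lt h_lt h_i h_gt /=.
  rewrite addn0; case: m le_im g_lt h_i h_gt => [|m] _ g_lt h_i h_gt.
    by rewrite !big_geq.
  rewrite big_ltn //= h_i h_gt // ltnNge ltnW ?g_lt //= add0n.
  rewrite big_add1 /=; apply: eq_big_nat => -[|k] // /andP[_ lt_k].
  by rewrite /= !h_gt //; lia.
rewrite (@big_cat_nat _ _ _ i.+1) //=; last by lia.
rewrite (big_ltn (m := i.+1)) //=.
rewrite h_i (h_lt i) // (g_lt i) //.
have low : (\sum_(1 <= k < i.+1) (h k.-1 < h k) =
            \sum_(1 <= k < i.+1) (g k.-1 < g k))%N.
  by apply: eq_big_nat => k ?; rewrite !h_lt //; lia.
rewrite low; case: (ltnP i.+1 m) => [lt_im|ge_im] /=; last first.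
  have -> : m = i.+1 by lia.
  by rewrite (big_geq (leqnn _)); lia.
(* The pair ([g i], [g i.+1]) gives way to ([g i], [m]), an ascent, and ([m], [g i.+1]), which is
   none. *)
rewrite [in RHS](@big_cat_nat _ _ _ i.+1) //=.
rewrite (big_ltn (m := i.+1) (n := m)) // (big_ltn (m := i.+2)) //=.
rewrite h_i h_gt ?leqnn // [(m < _)%N]ltnNge ltnW ?g_lt //= (big_add1 _ _ i.+2) /=.
suff -> : (\sum_(i.+2 <= k < m) (h k < h k.+1) =
          \sum_(i.+2 <= k < m) (g k.-1 < g k))%N by case: (g i < g i.+1)%N => /=; lia.
by apply: eq_big_nat => -[|k] // hk; rewrite /= !h_gt //; lia.
Qed.

(** As a word, [lift_perm i ord_max s] is [s] with the largest letter inserted at position [i]. *)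
Lemma ascents_lift_perm (m : nat) (i : 'I_m.+1) (s : 'S_m) :
  ascents (lift_perm i ord_max s) =
  (ascents s +
    ((0 < i) && ~~ ((i < m) && (word s i.-1 < word s i))))%N.
Proof.
rewrite !ascents_word; apply: ascents_insert.
- by rewrite -ltnS.
- by move=> k lt_km; rewrite -[k]/(val (Ordinal lt_km)) wordE.
- move=> k lt_ki.
  have lt_km : (k < m)%N by have := ltn_ord i; lia.
  have -> : k = lift i (Ordinal lt_km) :> nat by rewrite /= /bump leqNgt lt_ki.
  rewrite wordE lift_perm_lift /= /bump [in RHS]leqNgt lt_ki /=.
  by rewrite leqNgt ltn_ord -[(false + k)%N]/(val (Ordinal lt_km)) wordE.
- by rewrite wordE lift_perm_id.
- move=> k /andP[le_ik lt_km].
  have -> : k.+1 = lift i (Ordinal lt_km) :> nat by rewrite /= /bump le_ik.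
  rewrite wordE lift_perm_lift /= /bump.
  by rewrite leqNgt ltn_ord -[in RHS](_ : val (Ordinal lt_km) = k) // wordE.
Qed.

Lemma ascents_le (m : nat) (s : 'S_m) : (ascents s <= m)%N.
Proof. by rewrite -{2}(card_ord m) max_card. Qed.

(** Of the [m.+1] slots, those that leave the count unchanged are the front and the inside of each
    ascent. *)
Lemma sum_ascents_insert (m : nat) (s : 'S_m) :
  (\sum_(i < m.+1)
     ((0 < i) && ~~ ((i < m) && (word s i.-1 < word s i)))
   = m - ascents s)%N.
Proof.
apply/eqP; rewrite -(eqn_add2r (ascents s)) subnK ?ascents_le //.
rewrite ascents_word big_ord_recl /= add0n -(big_mkord xpredT
  (fun i => nat_of_bool (~~ ((i.+1 < m) && (word s i < word s i.+1))%N))) /=.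
case: m s => [|m] s; first by rewrite !big_geq.
rewrite big_nat_recr //= ltnn big_add1 /= addnAC -big_split /=.
rewrite (@eq_big_nat _ _ _ _ _ _ (fun=> 1%N)).
  by rewrite sum_nat_const_nat muln1 subn0 addn1.
by move=> k /andP[_ lt_km]; rewrite ltnS lt_km; case: (_ < _)%N.
Qed.

(** The slot is recovered as the preimage of [ord_max], and then [s] too; cardinalities agree. *)
Lemma lift_perm_max_bij (m : nat) :
  bijective (fun p : 'I_m.+1 * 'S_m => lift_perm p.1 ord_max p.2).
Proof.
apply: inj_card_bij; last by rewrite card_prod card_ord !card_Sn factS.
move=> [i s] [j t] /= e.
have eij : i = j.
  apply: (@perm_inj _ (lift_perm i ord_max s)).
  by rewrite {2}e !lift_perm_id.
rewrite -eij in e *; congr (_, _); apply/permP => k.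
apply: (@lift_inj _ ord_max); rewrite -!(@lift_perm_lift _ i ord_max) //.
by rewrite e.
Qed.

(** * Eulerian numbers: recurrence, symmetry, maximum and explicit formula *)

Lemma eulerian_sum (m l : nat) :
  eulerian m l = (\sum_(s : 'S_m) ((ascents s).+1 == l))%N.
Proof. by rewrite /eulerian -sum1dep_card big_mkcond. Qed.

(** A word with [l] ascents keeps its count in [l.+1] slots; one with [l - 1] ascents gains one in
    [m.+1 - l] slots. *)
Lemma eulerian_rec (m l : nat) :
  eulerian m.+1 l.+1 =
  (l.+1 * eulerian m l.+1 + (m.+1 - l) * eulerian m l)%N.
Proof.
rewrite !eulerian_sum (reindex _ (onW_bij _ (lift_perm_max_bij m))) /=.
rewrite -(pair_bigA _ (fun i s =>
  nat_of_bool ((ascents (lift_perm i ord_max s)).+1 == l.+1))) /= exchange_big.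
rewrite !big_distrr -big_split; apply: eq_bigr => s _ /=.
under eq_bigr do rewrite ascents_lift_perm eqSS.
have sum_ins := sum_ascents_insert s; have le_asc := ascents_le s.
set ins := fun i : 'I_m.+1 =>
  (0 < i)%N && ~~ ((i < m) && (word s i.-1 < word s i))%N.
rewrite (eq_bigr (fun i => (ascents s == l) * (1 - ins i)
   + ((ascents s).+1 == l) * ins i)%N); last first.
  move=> i _; rewrite -/(ins i); case: (ins i); rewrite ?addn0 ?addn1 /=; lia.
rewrite big_split -!big_distrr /= sumnB; last by move=> i _; case: (ins i).
rewrite sum_ins sum1_card card_ord eqSS.
by case: (eqVneq (ascents s) l); case: (eqVneq (ascents s).+1 l) => /=; lia.
Qed.

Lemma eulerian_n0 (m : nat) : eulerian m 0 = 0%N.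
Proof. by rewrite eulerian_sum big1. Qed.

Lemma eulerian_0n (l : nat) : eulerian 0 l = (l == 1)%N.
Proof.
have asc0 (s : 'S_0) : ascents s = 0%N by apply/eqP; rewrite -leqn0 ascents_le.
rewrite eulerian_sum; under eq_bigr do rewrite asc0.
by rewrite sum_nat_const card_Sn fact0 mul1n eq_sym.
Qed.

Lemma eulerian_gt (m l : nat) : (m.+1 < l)%N -> eulerian m l = 0%N.
Proof.
move=> lt_ml; rewrite eulerian_sum big1 // => s _.
by have := ascents_le s; case: eqP => //; lia.
Qed.

(** Sharper by one than [eulerian_gt]; the empty word is excluded because [eulerian 0 1] is 1. *)
Lemma eulerianS_gt (m l : nat) : (m.+1 < l)%N -> eulerian m.+1 l = 0%N.
Proof.
case: l => // l lt_ml; rewrite eulerian_rec eulerian_gt //.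
have -> : (m.+1 - l = 0)%N by lia.
by rewrite muln0.
Qed.

Lemma eulerian_n1 (m : nat) : eulerian m 1 = 1%N.
Proof.
elim: m => [|m IHm]; first by rewrite eulerian_0n.
by rewrite eulerian_rec IHm eulerian_n0 muln0.
Qed.

(** Exchanging [a] and [b] swaps the two terms of the recurrence. *)
Lemma eulerian_sym (m a b : nat) :
  (a + b = m.+2)%N -> eulerian m.+1 a = eulerian m.+1 b.
Proof.
elim: m a b => [|m IHm] [|a] [|b] eab;
  do ?[by [] | by rewrite eulerian_n0 eulerianS_gt //; lia].
  by have [-> ->] : a = 0%N /\ b = 0%N by lia.
rewrite !(eulerian_rec m.+1) (IHm a.+1 b) ?(IHm a b.+1); lia.
Qed.

Lemma eulerian_incr (m l : nat) :
  (2 * l.+1 <= m.+2)%N -> (eulerian m.+1 l <= eulerian m.+1 l.+1)%N.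
Proof.
elim: m l => [|m IHm] [|l] le_lm; rewrite ?eulerian_n0 //; first by lia.
rewrite !(eulerian_rec m.+1).
have le1 : (eulerian m.+1 l <= eulerian m.+1 l.+1)%N by apply: IHm; lia.
have le2 : (eulerian m.+1 l.+1 <= eulerian m.+1 l.+2)%N.
  (* Just past the range of the induction, [l.+1] and [l.+2] are mirror images, so equality
     holds. *)
  have [le_l|gt_l] := leqP (2 * l.+2) m.+2; first exact: IHm.
  by rewrite (@eulerian_sym m l.+1 l.+2) //; lia.
rewrite subSS subSn; last by lia.
(* Both sides compare with [m.+3] copies of the middle value [eulerian m.+1 l.+1]. *)
have := leq_mul (leqnn l.+2) le2; have := leq_mul (leqnn (m.+1 - l).+1) le1.
by move: (m.+1 - l)%N => d; lia.
Qed.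

Lemma eulerian_le_central (p l : nat) :
  (eulerian (2 * p).+1 l <= eulerian (2 * p).+1 p.+1)%N.
Proof.
have low k : (k <= p.+1)%N -> (eulerian (2 * p).+1 k <= eulerian (2 * p).+1 p.+1)%N.
  move=> le_kp; have -> : k = (p.+1 - (p.+1 - k))%N by lia.
  elim: (p.+1 - k)%N (leq_subr k p.+1) => [|d IHd] le_d; first by rewrite subn0.
  apply: leq_trans (IHd (ltnW le_d)).
  rewrite -(subnSK le_d); apply: eulerian_incr; lia.
have [le_l|gt_l] := leqP l p.+1; first exact: low.
have [le_l|gt_l2] := leqP l (2 * p).+2; last by rewrite eulerianS_gt //; lia.
by rewrite (@eulerian_sym _ l ((2 * p).+2 - l)) ?low //; lia.
Qed.

Lemma max_eulerian_odd (p : nat) :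
  max_eulerian (2 * p + 1) = eulerian (2 * p).+1 p.+1.
Proof.
rewrite /max_eulerian addn1; apply/eqP; rewrite eqn_leq; apply/andP; split.
  by apply/bigmax_leqP_seq => l _ _; exact: eulerian_le_central.
by apply: leq_bigmax_seq => //; rewrite mem_index_iota; lia.
Qed.

(* The range i < l (not i <= l) excludes the junk term 0 ^+ 0 = 1 at m = 0. *)
Lemma eulerian_explicit (R : comNzRingType) (m l : nat) :
  (eulerian m l)%:R =
  \sum_(i < l) (-1) ^+ i * 'C(m.+1, i)%:R * (l - i)%:R ^+ m :> R.
Proof.
elim: m l => [|m IHm] [|l]; rewrite ?eulerian_n0 ?big_ord0 //.
  rewrite eulerian_0n; case: l => [|l].
    by rewrite big_ord1 expr0 bin0 !mulr1.
  rewrite !big_ord_recl big1 => [|i _].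
    by rewrite /= !expr0 expr1 bin0 !mulr1 addr0 subrr.
  by rewrite bin_small ?mulr0 ?mul0r.
rewrite eulerian_rec natrD !natrM !IHm.
rewrite -!IHm.
(* Truncation is harmless: [eulerian m l] vanishes for [l > m.+1]. *)
have -> : (m.+1 - l)%:R * (eulerian m l)%:R =
    (m.+1%:R - l%:R) * (eulerian m l)%:R :> R.
  have [le_lm|gt_lm] := leqP l m.+1; first by rewrite natrB.
  by rewrite eulerian_gt // !mulr0.
rewrite !IHm !big_ord_recl /= !expr0 !bin0 !subn0 !mul1r mulrDr -exprS.
rewrite -addrA; congr (_ + _).
(* With term 0 split off, term [i.+1] of the first sum and term [i] of the second carry the same
   power of [l - i]. *)
rewrite !big_distrr -big_split; apply: eq_bigr => i _ /=.
have bin_i : i.+1%:R * 'C(m.+1, i.+1)%:R =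
    (m.+1%:R - i%:R) * 'C(m.+1, i)%:R :> R.
  have [le_im|gt_im] := leqP i m.+1; last first.
    by rewrite !bin_small ?mulr0 //; lia.
  by rewrite -natrM mul_bin_left natrM natrB.
rewrite /bump /= !add1n subSS (binS m.+1) natrD !exprS natrB 1?ltnW //.
move: bin_i; rewrite -!natr1.
set x := 'C(_, i.+1)%:R; set y := 'C(_, i)%:R.
set u := (_ - _) ^+ m; set e := (-1) ^+ i => bin_i.
apply: subr0_eq.
transitivity (- (e * u) * ((i%:R + 1) * x - (m%:R + 1 - i%:R) * y)); first ring.
by rewrite bin_i subrr mulr0.
Qed.

(** * Cauchy-Schwarz and the coefficients of [box R q n] *)

(** Lagrange's identity: the difference of the two sides is half the sum of all (a_i b_j - a_j
    b_i)^2. *)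
Lemma cauchy_schwarz_sum (R : realFieldType) (I : Type) (r : seq I)
    (a b : I -> R) :
  (\sum_(i <- r) a i * b i) ^+ 2 <=
  (\sum_(i <- r) a i ^+ 2) * (\sum_(i <- r) b i ^+ 2).
Proof.
set A := \sum_(i <- r) a i ^+ 2; set B := \sum_(i <- r) b i ^+ 2.
set C := \sum_(i <- r) a i * b i.
suff e : \sum_(i <- r) \sum_(j <- r) (a i * b j - a j * b i) ^+ 2 =
    A * B + B * A - 2 * (C * C).
  have : 0 <= A * B + B * A - 2 * (C * C).
    by rewrite -e; do 2!apply: sumr_ge0 => ? _; exact: sqr_ge0.
  by rewrite expr2; lra.
rewrite !big_distrlr mulr_sumr -big_split -sumrB; apply: eq_bigr => i _ /=.
rewrite mulr_sumr -big_split -sumrB; apply: eq_bigr => j _ /=; ring.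
Qed.

Definition box (R : nzRingType) (q n : nat) : {poly R} :=
  (\sum_(i < q) 'X^i) ^+ n.

Lemma box_count (R : nzRingType) (q n s : nat) :
  (box R q n)`_s =
  #|[set f : {ffun 'I_n -> 'I_q} | (\sum_i f i == s)%N]|%:R.
Proof.
rewrite /box -[n in LHS]card_ord -prodr_const bigA_distr_bigA /=.
under eq_bigr do rewrite prodrXr.
rewrite coef_sum -sum1dep_card natr_sum [RHS]big_mkcond /=.
by apply: eq_bigr => f _; rewrite coefXn eq_sym; case: eqP.
Qed.

(** Complementing each entry to [q.-1] is an involution on the tuples of [box_count]. *)
Lemma box_symm (R : nzRingType) (q n s : nat) :
  (s <= n * q.-1)%N -> (box R q n)`_(n * q.-1 - s) = (box R q n)`_s.
Proof.
move=> le_s; rewrite !box_count; congr (_ %:R).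
pose flip (f : {ffun 'I_n -> 'I_q}) := [ffun i => rev_ord (f i)].
have flipK : involutive flip.
  by move=> f; apply/ffunP => i; rewrite !ffunE rev_ordK.
have sum_flip f : (\sum_i flip f i = n * q.-1 - \sum_i f i)%N.
  have -> : (n * q.-1 = \sum_(i < n) q.-1)%N by rewrite sum_nat_const card_ord.
  rewrite -sumnB => [|i _]; last by have := ltn_ord (f i); lia.
  by apply: eq_bigr => i _; rewrite ffunE /=; have := ltn_ord (f i); lia.
rewrite -[RHS](card_imset _ (inv_inj flipK)); apply: eq_card => f.
rewrite inE; apply/eqP/imsetP => [sum_f|[g + ->]]; last first.
  by rewrite inE sum_flip => /eqP ->.
by exists (flip f); rewrite ?flipK // inE sum_flip sum_f subKn.
Qed.

Lemma coef_mul_1subX (R : comNzRingType) (P : {poly R}) (s : nat) :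
  (P * (1 - 'X))`_s.+1 = P`_s.+1 - P`_s.
Proof. by rewrite mulrBr mulr1 coefB coefMX. Qed.

(* The power series 1/(1-X)^(n+1) has coefficients C(k+n, n). *)
Lemma coef_div_1subX (R : comNzRingType) (P : {poly R}) (n s : nat) :
  P`_s = \sum_(j < s.+1) 'C(s - j + n, n)%:R * (P * (1 - 'X) ^+ n.+1)`_j.
Proof.
elim: n s P => [|n IHn] s P.
  elim: s => [|s IHs].
    by rewrite big_ord1 bin0 mul1r expr1 mulrBr mulr1 coefB coefMX /= subr0.
  rewrite big_ord_recr /= bin0 mul1r expr1 coef_mul_1subX -[LHS](addrNK P`_s).
  rewrite addrC; congr (_ + _); rewrite IHs; apply: eq_bigr => j _.
  by rewrite !bin0.
elim: s => [|s IHs].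
  by rewrite big_ord1 binn mul1r -!horner_coef0 hornerM horner_exp
    hornerD hornerN hornerX hornerC subr0 expr1n mulr1.
(* The increment is a coefficient of [P * (1 - 'X)], where the outer induction applies; Pascal's
   rule merges the two sums. *)
rewrite -[LHS](addrNK P`_s) -coef_mul_1subX IHs IHn.
under eq_bigr do rewrite -mulrA -exprS.
rewrite !(big_ord_recr s.+1) /= subnn !add0n !binn addrAC; congr (_ + _).
rewrite -big_split; apply: eq_bigr => j _ /=.
have le_js : (j <= s)%N by rewrite -ltnS.
by rewrite -mulrDl -natrD subSn // [X in 'C(X, n)]addSnnS addSn binS addnC.
Qed.

Lemma box_mul_1subX (R : comNzRingType) (q n : nat) :
  box R q n * (1 - 'X) ^+ n = (1 - 'X^q) ^+ n.
Proof.
rewrite /box -exprMn; congr (_ ^+ _).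
rewrite -opprB mulrN mulrC -subrX1; ring.
Qed.

(** Expands (1 - X^q)^(n+1) / (1 - X)^(n+1); the guard keeps [s - q * i] from being truncated. *)
Lemma box_coef (R : comNzRingType) (q n s : nat) :
  (0 < q)%N ->
  (box R q n.+1)`_s =
  \sum_(i < n.+2 | (q * i <= s)%N)
     (-1) ^+ i * 'C(n.+1, i)%:R * 'C(s - q * i + n, n)%:R.
Proof.
move=> q_gt0; rewrite (coef_div_1subX _ n) box_mul_1subX exprDn.
under eq_bigr => j _.
  rewrite coef_sum big_distrr /=.
  under eq_bigr => i _.
    rewrite expr1n mul1r exprNn -exprM coefMn.
    over.
  over.
rewrite exchange_big [RHS]big_mkcond /=; apply: eq_bigr => i _.
have coef_i (j : nat) : ((-1) ^+ i * 'X^(q * i) : {poly R})`_j =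
    (-1) ^+ i *+ (j == q * i)%N.
  by rewrite -signr_odd mulr_sign -[in RHS]signr_odd; case: odd;
     rewrite ?coefN coefXn ?mulNrn.
case: leqP => [le_s|gt_s]; last first.
  rewrite big1 // => j _; rewrite coef_i.
  by have /ltn_eqF -> : (j < q * i)%N; [have := ltn_ord j; lia | rewrite mul0rn mulr0].
rewrite (bigD1 (Ordinal (le_s : (q * i < s.+1)%N))) //= big1 => [|j ne_j].
  by rewrite coef_i eqxx addr0 mulr1n mulrnAr -mulr_natr; ring.
rewrite coef_i; have /negbTE -> : j != q * i :> nat by [].
by rewrite mul0rn mulr0.
Qed.

Lemma box_gt (R : nzRingType) (q n s : nat) :
  (n * q.-1 < s)%N -> (box R q n)`_s = 0.
Proof.
move=> lt_s; rewrite box_count (_ : [set _ | _] = finset.set0) ?cards0 //.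
apply/setP => f; rewrite !inE; apply/negbTE/eqP => sum_f.
have : (\sum_i f i <= \sum_(i < n) q.-1)%N.
  by apply: leq_sum => i _; have := ltn_ord (f i); lia.
by rewrite sum_f sum_nat_const card_ord leqNgt lt_s.
Qed.

(** By symmetry the central convolution is a sum of squares. The free bound [N] lets its range match
    that of another product. *)
Lemma box_central_sum (R : nzRingType) (q n N : nat) :
  (n * q.-1 <= N)%N ->
  (box R q (2 * n))`_(n * q.-1) = \sum_(0 <= j < N.+1) (box R q n)`_j ^+ 2.
Proof.
move=> le_N; rewrite (@big_cat_nat _ _ _ (n * q.-1).+1) //=.
rewrite [X in _ + X]big_nat_cond [X in _ + X]big1 ?addr0 => [|j]; last first.
  by rewrite andbT => /andP[lt_j _]; rewrite box_gt // expr0n.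
rewrite {1}/box mul2n -addnn exprD -/(box R q n) coefM big_mkord.
by apply: eq_bigr => j _; rewrite box_symm ?expr2 // -ltnS.
Qed.

Lemma box_central_le (R : realFieldType) (q n : nat) :
  (box R q (2 * n.+1))`_(n.+1 * q.-1) ^+ 2 <=
  (box R q (2 * n))`_(n * q.-1) * (box R q (2 * n.+2))`_(n.+2 * q.-1).
Proof.
(* The uneven splitting of 2n+2 into n and n+2 brings in both neighbours. *)
have -> : box R q (2 * n.+1) = box R q n * box R q n.+2.
  by rewrite /box -exprD; congr (_ ^+ _); lia.
set N := (n.+1 * q.-1)%N; set M := (n.+2 * q.-1)%N.
have le_NM : (N.+1 <= M.+1)%N by rewrite ltnS leq_mul2r leqnSn orbT.
rewrite coefM (@box_central_sum _ _ n N) ?leq_mul2r ?leqnSn ?orbT //.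
rewrite (@box_central_sum _ _ n.+2 M) //.
apply: le_trans (cauchy_schwarz_sum _ _ _) _; rewrite big_mkord.
apply: ler_wpM2l; first by apply: sumr_ge0 => j _; exact: sqr_ge0.
(* Reversed, this is the sum of squares up to [N]; those from [N.+1] to [M] are nonnegative. *)
rewrite -(big_mkord xpredT (fun j => (box R q n.+2)`_(N - j) ^+ 2)) big_nat_rev.
rewrite (@big_cat_nat _ _ _ N.+1 0 M.+1) //= -[leLHS]addr0; apply: lerD.
  rewrite le_eqVlt; apply/orP; left; apply/eqP.
  by apply: eq_big_nat => j /andP[_ lt_j]; rewrite add0n subSS subKn.
by apply: sumr_ge0 => j _; exact: sqr_ge0.
Qed.

(** * Limits as [q] tends to infinity *)

Import numFieldNormedType.Exports.
Local Open Scope classical_set_scope.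

Lemma cvg_natV (R : realType) : (q%:R^-1 : R) @[q --> \oo] --> 0.
Proof.
apply/gtr0_cvgV0; first by near=> q; rewrite ltr0n; near: q; exact: nbhs_infty_gt.
exact: cvgr_idn.
Unshelve. all: by end_near.
Qed.

(** Each of the [d] factors, divided by [q], tends to [a]. *)
Lemma cvg_ffact (R : realType) (a b d : nat) : (0 < a)%N ->
  ((a * q + b) ^_ d)%:R / q%:R ^+ d @[q --> \oo] --> (a%:R ^+ d : R).
Proof.
move=> a_gt0; elim: d => [|d IHd].
  under eq_fun do rewrite ffactn0 expr0 divr1.
  exact: cvg_cst.
have factor : (a * q + b - d)%:R / q%:R @[q --> \oo] --> (a%:R : R).
  have : a%:R + (b%:R - d%:R) * q%:R^-1 @[q --> \oo] --> (a%:R + (b%:R - d%:R) * 0 : R).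
    by apply: cvgD; [exact: cvg_cst | apply: cvgMr; exact: cvg_natV].
  rewrite mulr0 addr0; apply: cvg_trans; apply: near_eq_cvg.
  near=> q.
  have q_gt0 : (0 < q)%N by near: q; exact: nbhs_infty_gt.
  have le_dq : (d <= q)%N by near: q; exact: nbhs_infty_ge.
  have q_neq0 : q%:R != 0 :> R by rewrite pnatr_eq0 -lt0n.
  rewrite natrB; last by nia.
  by rewrite natrD natrM; field.
rewrite exprSr; under eq_fun do rewrite ffactnSr natrM exprSr invfM mulrACA.
exact: cvgM.
Unshelve. all: by end_near.
Qed.

Lemma cvg_bin (R : realType) (a b d : nat) : (0 < a)%N ->
  'C(a * q + b, d)%:R / q%:R ^+ d @[q --> \oo] --> (a%:R ^+ d / d`!%:R : R).
Proof.
move=> a_gt0; have d_neq0 : d`!%:R != 0 :> R by rewrite pnatr_eq0 -lt0n fact_gt0.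
have -> : (fun q => 'C(a * q + b, d)%:R / q%:R ^+ d : R) =
    (fun q => ((a * q + b) ^_ d)%:R / q%:R ^+ d * d`!%:R^-1).
  by apply/funext => q; rewrite -bin_ffact natrM mulrAC mulfK.
apply: cvgMl; exact: cvg_ffact.
Qed.

Lemma cvg_box_central (R : realType) (p : nat) :
  (box R q (2 * p.+1))`_(p.+1 * q.-1) / q%:R ^+ (2 * p).+1 @[q --> \oo] -->
  ((eulerian (2 * p).+1 p.+1)%:R / ((2 * p).+1)`!%:R : R).
Proof.
set d := (2 * p).+1.
pose c i : R := (-1) ^+ i * 'C(d.+1, i)%:R.
have lim_sum : \sum_(i < p.+1)
      c i * ('C((p.+1 - i) * q + p, d)%:R / q%:R ^+ d) @[q --> \oo] -->
    (\sum_(i < p.+1) c i * ((p.+1 - i)%:R ^+ d / d`!%:R) : R).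
  apply: (cvg_big add_continuous) => i _.
  by apply: cvgMr; apply: cvg_bin; rewrite subn_gt0.
have -> : (eulerian d p.+1)%:R / d`!%:R =
    \sum_(i < p.+1) c i * ((p.+1 - i)%:R ^+ d / d`!%:R) :> R.
  by rewrite eulerian_explicit mulr_suml; apply: eq_bigr => i _; rewrite mulrA.
move: lim_sum; apply: cvg_trans; apply: near_eq_cvg; near=> q.
(* For such [q], the guard [q * i <= p.+1 * q.-1] of [box_coef] means exactly [i <= p]. *)
have lt_pq : (p < q)%N by near: q; exact: nbhs_infty_gt.
have -> : (2 * p.+1 = d.+1)%N by rewrite /d; lia.
rewrite box_coef; last by lia.
rewrite mulr_suml (big_ord_widen d.+2 (fun i => c i *
  ('C((p.+1 - i) * q + p, d)%:R / q%:R ^+ d))); last by rewrite /d; lia.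
have [r def_q] : exists r, q = r.+1 by exists q.-1; lia.
rewrite def_q in lt_pq *; rewrite succnK.
apply: eq_big => [i|i /= lt_ip].
  by apply/idP/idP; nia.
(* The upper indices agree: (p+1)(q-1) - qi + 2p+1 = (p+1-i)q + p. *)
rewrite mulrA; congr (_ * 'C(_, _)%:R / _).
have [k def_p] : exists k, (p = k + i)%N by exists (p - i)%N; lia.
have -> : (p.+1 - i = k.+1)%N by lia.
have -> : (p.+1 * r - r.+1 * i = k.+1 * r - i)%N.
  rewrite def_p -addSn mulnDl [(r.+1 * i)%N]mulSn [(r * i)%N]mulnC.
  by rewrite [(i + _)%N]addnC subnDA addnK.
have : (i <= k.+1 * r)%N by apply: leq_trans (leq_pmull _ _); lia.
rewrite /d mulnS; move: (k.+1 * r)%N (nat_of_ord i) def_p => x j def_p'.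
by clear -def_p'; lia.
Unshelve. all: by end_near.
Qed.

(** * Log-convexity and convexity of the ratios *)

Lemma eulerian_ratio_odd (R : realType) (p : nat) :
  eulerian_ratio R (2 * p + 1) =
  (eulerian (2 * p).+1 p.+1)%:R / ((2 * p).+1)`!%:R.
Proof. by rewrite /eulerian_ratio max_eulerian_odd addn1. Qed.

Lemma eulerian_ratio_odd_gt0 (R : realType) (p : nat) :
  0 < eulerian_ratio R (2 * p + 1).
Proof.
rewrite eulerian_ratio_odd divr_gt0 ?ltr0n ?fact_gt0 //.
by apply: leq_trans (eulerian_le_central p 1); rewrite eulerian_n1.
Qed.

(** [box_central_le] passes to the limit: both sides are divided by the same power of [q], as
    2(2p+3) = (2p+1) + (2p+5). *)
Lemma eulerian_ratio_odd_log_convex (R : realType) (p : nat) :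
  eulerian_ratio R (2 * p.+1 + 1) ^+ 2 <=
  eulerian_ratio R (2 * p + 1) * eulerian_ratio R (2 * p.+2 + 1).
Proof.
rewrite !eulerian_ratio_odd expr2.
apply: ler_cvg_to (cvgM (cvg_box_central (p := p.+1)) (cvg_box_central (p := p.+1)))
  (cvgM (cvg_box_central (p := p)) (cvg_box_central (p := p.+2))) _.
apply: nearW => q; rewrite /= -expr2 expr_div_n mulrACA -invfM -exprM -exprD.
rewrite (_ : (2 * p.+1).+1 * 2 = (2 * p).+1 + (2 * p.+2).+1)%N; last by lia.
by apply: ler_wpM2r; rewrite ?box_central_le // invr_ge0 exprn_ge0.
Qed.

Theorem proposition4p3 (R : realType) :
  convex_seq (fun p : nat => eulerian_ratio R (2 * p + 1)%N) /\
  log_convex_seq (fun p : nat => eulerian_ratio R (2 * p + 1)%N).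
Proof.
split; last first.
  by split=> p; [exact: eulerian_ratio_odd_gt0
               | exact: eulerian_ratio_odd_log_convex].
move=> p.
have := eulerian_ratio_odd_log_convex R p.
have := eulerian_ratio_odd_gt0 R p; have := eulerian_ratio_odd_gt0 R p.+1.
have := eulerian_ratio_odd_gt0 R p.+2.
set x := eulerian_ratio R _; set y := eulerian_ratio R _.
set z := eulerian_ratio R _ => x_gt0 y_gt0 z_gt0 le_y.
(* (2y)^2 <= 4zx = (z+x)^2 - (z-x)^2. *)
rewrite -ler_sqr ?nnegrE; [|lra|lra].
have := sqr_ge0 (z - x); nra.
Qed.
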